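(* Let $G=(V,A)$ be a digraph, $s,t\in V$, $c_a\in\mathbb{R}^d_{\geq 0}$ ($a\in A$) arc costs, $\pi$ a monotone and admissible heuristic for $(G,s,t,c)$, and $\beta_t$ a dominance bound for $(G,s,t,c)$. Run the Targeted Multiobjective Dijkstra Algorithm (T-MDA) described in the context on this input. At the end of the algorithm, the list $\mathcal{P}_{st}$ is a minimal complete set of efficient $s$-$t$-paths.
   Context: Costs of a path $p$: $c(p)=\sum_{a\in p}c_a$. For vectors $x,y\in\mathbb{R}^d$, $x\le y$ means componentwise. Two $v$-$w$-paths: $p$ dominates $q$ if $c(p)\le c(q)$ and $c_j(p)<c_j(q)$ for some $j$; a $v$-$w$-path is efficient if no $v$-$w$-path dominates it, and its cost vector is then called non-dominated. A minimal complete set of efficient $s$-$t$-paths is a set of efficient $s$-$t$-paths containing, for every non-dominated $s$-$t$ cost vector, exactly one path with that cost. A heuristic $\pi:V\to\mathbb{R}^d_{\ge0}$ is admissible if $\pi(v)\le c(p)$ for every $v\in V$ and every efficient $v$-$t$-path $p$, and monotone if $\pi(t)=0$ and $\pi(u)\le c_{uv}+\pi(v)$ for all $(u,v)\in A$. A dominance bound is a vector $\beta\in\mathbb{R}^d$ such that there is no efficient $s$-$t$-path $p$ with $\beta\le c(p)$. For an $s$-$v$-path $p$, $\bar c(p):=c(p)+\pi(v)$. $x\prec_{lex}y$ means that in the first coordinate $j$ where $x,y$ differ, $x_j<y_j$. For a set of paths $\mathcal{X}$ and $y\in\mathbb{R}^d$, write $c(\mathcal{X})\preceq_D y$ if some $q\in\mathcal{X}$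 has $c(q)\le y$. T-MDA: Data structures: a priority queue $Q$ of paths containing at most one path ending at each node and whose extractMin returns a path with lexicographically minimal $\bar c$; for every $v\in V$ a list $\mathcal{P}_{sv}$ (initially empty); for every arc $(u,v)\in A$ a list $\mathcal{NQP}_{uv}$ (initially empty). Initially $Q$ contains only the empty path at $s$ (cost $0$). While $Q\neq\emptyset$: (1) Extract $p$ from $Q$ (lex. minimal $\bar c$); let $v$ be its last node ($s$ for the empty path); append $p$ to $\mathcal{P}_{sv}$. (2) Next queue path search: set $p^{new}:=\mathtt{NULL}$ (treated as having $\bar c=(\infty,\dots,\infty)$). For each $u$ with $(u,v)\in A$, scan $\mathcal{NQP}_{uv}$ from the front; for the current element $p_v$: if $c(\mathcal{P}_{st})\preceq_D\bar c(p_v)$ or $\beta_t\le\bar c(p_v)$, remove $p_v$ from the list and continue with the next element; otherwise, if neither $c(\mathcal{P}_{sv})\preceq_D c(p_v)$ nor $c(p)\le c(p_v)$ holds, then set $p^{new}:=p_v$ if $\bar c(p_v)\prec_{lex}\bar c(p^{new})$, and stop scanning this list (without removing $p_v$); otherwise continue with the next element. After all lists are processed, if $p^{new}\ne\mathtt{NULL}$, insert it into $Q$. (3) If $v=t$, go to the next iteration. (4) For each $w$ with $(v,w)\in A$: let $q^{new}:=p\circ(v,w)$. If $c(\mathcal{P}_{st})\preceq_D\bar c(q^{new})$ or $\beta_t\le\bar c(q^{new})$, discard $q^{new}$. Otherwise, if $c(\mathcal{P}_{sw})\preceq_D c(q^{new})$ does not hold: if $Q$ contains no path ending at $w$, insert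 $q^{new}$ into $Q$; else let $q$ be the path in $Q$ ending at $w$; if $\bar c(q^{new})\prec_{lex}\bar c(q)$, replace $q$ by $q^{new}$ in $Q$ and insert $q$ at the beginning of $\mathcal{NQP}_{xw}$, where $(x,w)$ is the last arc of $q$; otherwise append $q^{new}$ at the end of $\mathcal{NQP}_{vw}$. The output is the list $\mathcal{P}_{st}$. *)

(* Defs.v *)
From mathcomp Require Import all_boot all_order all_algebra.
From mathcomp Require Import reals.

Set Implicit Arguments.
Unset Strict Implicit.
Unset Printing Implicit Defensive.

Import Order.TTheory GRing.Theory Num.Theory.
Local Open Scope ring_scope.

Section Vectors.
Context {R : realType} {d : nat}.
Implicit Types x y : 'rV[R]_d.

Definition vle x y : bool := [forall j, x 0 j <= y 0 j].

Definition lexlt x y : bool :=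
  [exists j, (x 0 j < y 0 j) && [forall i : 'I_d, (i < j)%N ==> (x 0 i == y 0 i)]].

Definition dominates x y : bool := vle x y && [exists j, x 0 j < y 0 j].

End Vectors.

(* A digraph is a relation [A] on the finite node type [V]. A path is given by
   its start node [u] and the sequence [p] of its remaining nodes; the empty
   path at [u] is [[::]]. Only the values of [c] on arcs are ever used. *)
Section Paths.
Context {R : realType} {d : nat} {V : finType}.
Variables (A : rel V) (c : V -> V -> 'rV[R]_d).
Implicit Types (u v w : V) (p q : seq V).

Definition arcs u p : seq (V * V) := zip (u :: p) p.

Definition cost u p : 'rV[R]_d := \sum_(a <- arcs u p) c a.1 a.2.

Definition is_path u v p : bool :=
  [&& path A u p, last u p == v & uniq (u :: p)].

Definition efficient u v p : Prop :=
  is_path u v p /\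
  forall q, is_path u v q -> ~~ dominates (cost u q) (cost u p).

Definition nondominated u v (y : 'rV[R]_d) : Prop :=
  exists2 p, efficient u v p & cost u p = y.

Definition minimal_complete_set u v (L : seq (seq V)) : Prop :=
  [/\ uniq L,
      forall p, p \in L -> efficient u v p
    & forall y, nondominated u v y -> exists! p, p \in L /\ cost u p = y].

Definition admissible (t : V) (pi : V -> 'rV[R]_d) : Prop :=
  forall v p, efficient v t p -> vle (pi v) (cost v p).

Definition monotone (t : V) (pi : V -> 'rV[R]_d) : Prop :=
  pi t = 0 /\ forall u v, A u v -> vle (pi u) (c u v + pi v).

Definition dominance_bound (s t : V) (beta : 'rV[R]_d) : Prop :=
  ~ exists2 p, efficient s t p & vle beta (cost s p).

End Paths.

(* [queue S v] is the path of the priority queue that ends at [v], if any, so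
   that the queue holds at most one path per node. [plist S v] is the list
   P_sv, and [nqp S (u, v)] is the list NQP_uv. All stored paths start at [s]
   and hence are represented by the sequence of their nodes after [s]. *)
Record state (V : finType) := State {
  queue : V -> option (seq V);
  plist : V -> seq (seq V);
  nqp : V * V -> seq (seq V)
}.

Definition upd (T : eqType) (U : Type) (f : T -> U) (a : T) (b : U) : T -> U :=
  fun x => if x == a then b else f x.

Section TMDA.
Context {R : realType} {d : nat} {V : finType}.
Variables (A : rel V) (c : V -> V -> 'rV[R]_d) (s t : V).
Variables (pi : V -> 'rV[R]_d) (beta : 'rV[R]_d).
Implicit Types (u v w : V) (p q : seq V) (S : state V).

Definition end_node p : V := last s p.

(* For nonempty [p], the node [x] such that the last arc of [p] is [(x, w)]. *)
Definition penultimate p : V := nth s (s :: p) (size p).-1.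

Definition cbar p : 'rV[R]_d := cost c s p + pi (end_node p).

(* c(X) <=_D y *)
Definition covers (X : seq (seq V)) (y : 'rV[R]_d) : bool :=
  has (fun q => vle (cost c s q) y) X.

Definition prunable (P : V -> seq (seq V)) p : bool :=
  covers (P t) (cbar p) || vle beta (cbar p).

(* [None] is the NULL path, whose cbar is infinite in every coordinate. *)
Definition lex_better p (o : option (seq V)) : bool :=
  if o is Some q then lexlt (cbar p) (cbar q) else true.

Definition enqueue p (Q : V -> option (seq V)) : V -> option (seq V) :=
  upd Q (end_node p) (Some p).

Definition initial_state : state V :=
  State (enqueue [::] (fun=> None)) (fun=> [::]) (fun=> [::]).

(* The scan of one list [L] = NQP_uv after [p] has been extracted; it returns
   the updated list and the updated value of p^new. *)
Fixpoint scan (P : V -> seq (seq V)) p (L : seq (seq V))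
    (pnew : option (seq V)) : seq (seq V) * option (seq V) :=
  if L is r :: L' then
    if prunable P r then scan P p L' pnew
    else if ~~ covers (P (end_node p)) (cost c s r)
            && ~~ vle (cost c s p) (cost c s r)
    then (L, if lex_better r pnew then Some r else pnew)
    else let: (L1, o) := scan P p L' pnew in (r :: L1, o)
  else ([::], pnew).

(* [us] lists the in-neighbours of the end node of [p] in scanning order. *)
Definition next_queue_path S p (us : seq V) : state V :=
  let v := end_node p in
  let: (N, pnew) :=
    foldl (fun (acc : (V * V -> seq (seq V)) * option (seq V)) u =>
             let: (N, o) := acc in
             let: (L, o') := scan (plist S) p (N (u, v)) o in
             (upd N (u, v) L, o'))
          (nqp S, None) us in
  State (if pnew is Some r then enqueue r (queue S) else queue S) (plist S) N.

Definition propagate_arc p S w : state V :=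
  let v := end_node p in
  let qnew := rcons p w in
  let: State Q P N := S in
  if prunable P qnew || covers (P w) (cost c s qnew) then S
  else if Q w is Some q then
    if lexlt (cbar qnew) (cbar q) then
      let x := penultimate q in
      State (enqueue qnew Q) P (upd N (x, w) (q :: N (x, w)))
    else State Q P (upd N (v, w) (rcons (N (v, w)) qnew))
  else State (enqueue qnew Q) P N.

(* [ws] lists the out-neighbours of the end node of [p]. *)
Definition propagate S p (ws : seq V) : state V :=
  if end_node p == t then S else foldl (propagate_arc p) S ws.

Definition extract S p : state V :=
  let v := end_node p in
  State (upd (queue S) v None)
        (upd (plist S) v (rcons (plist S v) p))
        (nqp S).

Definition extractable S p : Prop :=
  queue S (end_node p) = Some p /\
  forall v q, queue S v = Some q -> ~~ lexlt (cbar q) (cbar p).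

(* One iteration of the main loop. The choice of a lexicographically minimal
   path and the orders in which the in- and out-neighbours are processed are
   left open by the algorithm, hence the nondeterminism. *)
Definition iteration S S' : Prop :=
  exists p us ws,
    [/\ extractable S p,
        perm_eq us [seq u <- enum V | A u (end_node p)],
        perm_eq ws [seq w <- enum V | A (end_node p) w]
      & S' = propagate (next_queue_path (extract S p) p us) p ws].

Inductive reachable : state V -> Prop :=
| reachable_init : reachable initial_state
| reachable_step S S' : reachable S -> iteration S S' -> reachable S'.

Definition finished S : Prop := forall v, queue S v = None.

Definition infinite_run (r : nat -> state V) : Prop :=
  r 0%N = initial_state /\ forall n, iteration (r n) (r n.+1).

End TMDA.

(* Main.v *)
(* Along a run, every stored path extends an extracted one by an arc, and by
   monotonicity of [pi] this does not decrease [cbar]. Call a path live if it is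
   neither prunable nor covered by the extracted paths to its end node. The live
   part of each NQP list stays lexicographically sorted, and a queued path is
   lexicographically minimal among the live NQP paths to its end node; hence
   paths are extracted in lexicographically nondecreasing order of [cbar]. No
   extracted path is covered by the earlier ones, so each is simple and occurs
   once, which gives termination. When the queue is empty, no generated path is
   live. For an efficient s-t-path [q], monotonicity shows that a path that
   covers the cost of a prefix of [q] can be prunable only if P_st covers the
   cost of [q]; following the prefixes of [q] then shows that P_st covers
   [q]. The extraction order turns this into efficiency of all paths in P_st. *)
Require Import Defs.
From mathcomp Require Import all_boot all_order all_algebra.
From mathcomp Require Import reals.

Set Implicit Arguments.
Unset Strict Implicit.
Unset Printing Implicit Defensive.

Import Order.TTheory GRing.Theory Num.Theory.
Local Open Scope ring_scope.

(** * Componentwise and lexicographic orders on vectors *)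

Section VectorOrders.
Context {R : realType} {d : nat}.
Implicit Types x y z : 'rV[R]_d.

Lemma vle_refl x : vle x x.
Proof. by apply/forallP => j. Qed.

Lemma vle_trans y x z : vle x y -> vle y z -> vle x z.
Proof.
move=> /forallP xy /forallP yz; apply/forallP => j.
exact: le_trans (xy j) (yz j).
Qed.

Lemma vle_add x y x' y' : vle x y -> vle x' y' -> vle (x + x') (y + y').
Proof.
by move=> /forallP h /forallP h'; apply/forallP => j; rewrite !mxE lerD.
Qed.

Lemma vle_anti x y : vle x y -> vle y x -> x = y.
Proof.
move=> /forallP xy /forallP yx; apply/rowP => j.
by apply/eqP; rewrite eq_le xy yx.
Qed.

Lemma vle_dominates x y : vle x y -> x != y -> dominates x y.
Proof.
move=> le_xy ne_xy; rewrite /dominates le_xy /=; apply: contraNT ne_xy.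
rewrite negb_exists => /forallP ge; apply/eqP/(vle_anti le_xy)/forallP => j.
by rewrite leNgt ge.
Qed.

(** Stated as a negation to match the failed comparisons of the algorithm; by totality it is the
    reflexive closure of [lexlt]. *)
Definition lexle x y : bool := ~~ lexlt y x.

Lemma lexltP x y :
  reflect (exists2 j, x 0 j < y 0 j
                    & forall i : 'I_d, (i < j)%N -> x 0 i = y 0 i)
          (lexlt x y).
Proof.
rewrite /lexlt; apply: (iffP existsP) => [[j /andP[lt_xy /forallP eq_xy]]|].
  by exists j => // i ij; apply/eqP; have := eq_xy i; rewrite ij.
case=> j lt_xy eq_xy; exists j; rewrite lt_xy /=; apply/forallP => i.
by apply/implyP => ij; rewrite eq_xy.
Qed.

Lemma lexlt_irrefl x : lexlt x x = false.
Proof. by apply/lexltP => -[j]; rewrite ltxx. Qed.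

Lemma lexlt_trans y x z : lexlt x y -> lexlt y z -> lexlt x z.
Proof.
move=> /lexltP[i lt_xy eq_xy] /lexltP[j lt_yz eq_yz]; apply/lexltP.
case: (ltngtP i j) => [ij|ji|/val_inj ij].
- exists i => [|k ki]; first by rewrite -eq_yz.
  by rewrite eq_xy // eq_yz // (ltn_trans ki).
- exists j => [|k kj]; first by rewrite eq_xy.
  by rewrite eq_xy ?eq_yz // (ltn_trans kj).
- exists i => [|k ki]; first by rewrite (lt_trans lt_xy) // ij.
  by rewrite eq_xy // eq_yz // -ij.
Qed.

Lemma lexlt_total x y : [|| x == y, lexlt x y | lexlt y x].
Proof.
case: eqP => //= /eqP ne_xy.
have /existsP[j0 ne0] : [exists j, x 0 j != y 0 j].
  apply: contraNT ne_xy; rewrite negb_exists => /forallP eqxy.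
  by apply/eqP/rowP => j; apply/eqP; have := eqxy j; rewrite negbK.
(* The first coordinate in which the vectors differ decides the comparison. *)
case: (arg_minnP (fun j : 'I_d => val j)
                 (P := fun j => x 0 j != y 0 j) ne0) => j nej minj.
have eqk (k : 'I_d) : (k < j)%N -> x 0 k = y 0 k.
  by move=> kj; apply/eqP; apply: contraTT kj => /minj; rewrite -leqNgt.
case: (ltgtP (x 0 j) (y 0 j)) nej => // ltxy _; apply/orP; [left|right];
  by apply/lexltP; exists j => // k /eqk.
Qed.

Lemma lexle_refl x : lexle x x.
Proof. by rewrite /lexle lexlt_irrefl. Qed.

Lemma lexle_eqVlt x y : lexle x y -> x = y \/ lexlt x y.
Proof.
move=> /negP xy; case/or3P: (lexlt_total x y) => [/eqP|lt_xy|/xy //].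
- by left.
- by right.
Qed.

Lemma lexltW x y : lexlt x y -> lexle x y.
Proof.
by move=> xy; apply/negP => /(lexlt_trans xy); rewrite lexlt_irrefl.
Qed.

Lemma lexle_trans y x z : lexle x y -> lexle y z -> lexle x z.
Proof.
case/lexle_eqVlt => [->|xy] // /lexle_eqVlt[<-|yz]; apply: lexltW => //.
exact: lexlt_trans yz.
Qed.

(** Paths with the same end node share the heuristic term, and paths with the same last arc share
    its cost; this cancels such common summands. *)
Lemma lexlt_add2r z x y : lexlt (x + z) (y + z) = lexlt x y.
Proof.
apply/lexltP/lexltP => -[j ltj eqj]; exists j => [|i /eqj].
- by move: ltj; rewrite !mxE ltrD2r.
- by rewrite !mxE => /addIr.
- by rewrite !mxE ltrD2r.
- by rewrite !mxE => ->.
Qed.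

Lemma vle_lexle x y : vle x y -> lexle x y.
Proof.
by move=> /forallP xy; apply/lexltP => -[j]; rewrite ltNge xy.
Qed.

Lemma dominates_lexlt x y : dominates x y -> lexlt x y.
Proof.
by case/andP=> /vle_lexle/lexle_eqVlt[->|//] /existsP[j]; rewrite ltxx.
Qed.

End VectorOrders.

(** * Path costs, and efficient paths below simple ones *)

Section Paths.
Context {R : realType} {d : nat} {V : finType}.
Variables (A : rel V) (c : V -> V -> 'rV[R]_d).
Implicit Types (u v w : V) (p q r : seq V).

Lemma cost_nil u : cost c u [::] = 0.
Proof. by rewrite /cost /arcs /= big_nil. Qed.

Lemma cost_cons u v p : cost c u (v :: p) = c u v + cost c v p.
Proof. by rewrite /cost /arcs /= big_cons. Qed.

Lemma cost_cat u p q : cost c u (p ++ q) = cost c u p + cost c (last u p) q.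
Proof.
elim: p u => [|v p IHp] u /=; first by rewrite cost_nil add0r.
by rewrite !cost_cons IHp addrA.
Qed.

Lemma cost_rcons u p w : cost c u (rcons p w) = cost c u p + c (last u p) w.
Proof. by rewrite -cats1 cost_cat cost_cons cost_nil addr0. Qed.

Hypothesis c_ge0 : forall u v, A u v -> vle 0 (c u v).

Lemma cost_ge0 u p : path A u p -> vle 0 (cost c u p).
Proof.
elim: p u => [|v p IHp] u /=; first by rewrite cost_nil vle_refl.
case/andP => Auv pathp; rewrite cost_cons -[0]addr0.
exact: vle_add (c_ge0 Auv) (IHp _ pathp).
Qed.

(** The monotonicity inequalities telescope along [p], ending in [pi t = 0]. *)
Lemma monotone_le_cost t pi u p :
  monotone A c t pi -> path A u p -> last u p = t -> vle (pi u) (cost c u p).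
Proof.
move=> [pit mon]; elim: p u => [|v p IHp] u /=.
  by move=> _ ->; rewrite pit cost_nil vle_refl.
case/andP => Auv pathp lastp; rewrite cost_cons.
apply: vle_trans (mon _ _ Auv) _.
exact: vle_add (vle_refl _) (IHp _ pathp lastp).
Qed.

Lemma size_simple_path u v p : is_path A u v p -> (size p <= #|V|)%N.
Proof.
case/and3P => _ _ /card_uniqP /= sz; apply/ltnW.
by rewrite -sz max_card.
Qed.

(** Among the finitely many simple paths of cost at most that of [q], one with the least sum of
    coordinates is efficient: a dominating path would also lie below [q] and have a smaller sum.
    Bounded sequences provide the finite type to minimise over. *)
Lemma efficient_below u v q : is_path A u v q ->
  exists2 p, efficient A c u v p & vle (cost c u p) (cost c u q).
Proof.
move=> simq; pose weight p := \sum_j cost c u p 0 j.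
pose ok (p : #|V|.-bseq V) :=
  is_path A u v p && vle (cost c u p) (cost c u q).
have okq : ok (Bseq (size_simple_path simq)) by rewrite /ok /= simq vle_refl.
case: (Order.TotalTheory.arg_minP (P := ok) (fun p : #|V|.-bseq V => weight p) okq).
move=> p /andP[simp le_pq] minp; exists p => //; split=> // r simr.
apply/negP => /andP[/forallP le_rp /existsP[j lt_rp]].
have okr : ok (Bseq (size_simple_path simr)).
  by rewrite /ok /= simr (vle_trans _ le_pq) //; apply/forallP.
have := minp _ okr; rewrite leNgt => /negP; apply.
rewrite /weight (bigD1 j) //= [ltRHS](bigD1 j) //= ltr_leD //.
by apply: ler_sum => i _; apply: le_rp.
Qed.

End Paths.

(** * The loop invariant *)

Section Run.
Context {R : realType} {d : nat} {V : finType}.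
Variables (A : rel V) (c : V -> V -> 'rV[R]_d) (s t : V).
Variables (pi : V -> 'rV[R]_d) (beta : 'rV[R]_d).
Hypothesis c_ge0 : forall u v, A u v -> vle 0 (c u v).
Hypothesis pi_mono : monotone A c t pi.
Implicit Types (u v w : V) (p q r g : seq V) (P : V -> seq (seq V)).
Implicit Types (S : state V) (E : seq (seq V)).

Local Notation cost := (cost c s).
Local Notation cbar := (cbar c s pi).
Local Notation end_node := (end_node s).
Local Notation covers := (covers c s).
Local Notation prunable := (prunable c s t pi beta).
Local Notation lex_better := (lex_better c s pi).
Local Notation enqueue := (enqueue s).
Local Notation scan := (scan c s t pi beta).

Definition live P g := ~~ prunable P g && ~~ covers (P (end_node g)) (cost g).

Definition child P u v g : Prop :=
  exists2 r, r \in P u & g = rcons r v /\ A u v.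

Definition generated P g : Prop :=
  g = [::] \/
  exists r w, [/\ g = rcons r w, r \in P (end_node r), end_node r != t
                & A (end_node r) w].

(** Extraction appends at the end of a list, so the list order in [sound_order] is the order of
    extraction. *)
Record sound P : Prop := Sound {
  sound_path : forall u r, r \in P u -> is_path A s u r;
  sound_prefix : forall u r w, rcons r w \in P u -> r \in P (end_node r);
  sound_order : forall u,
    pairwise (fun q r => ~~ vle (cost q) (cost r) && lexle (cbar q) (cbar r))
             (P u)
}.

(* [E] collects the generated paths that the current iteration has not yet
   processed. *)
Record inv E S : Prop := Inv {
  inv_sound : sound (plist S);
  inv_queue : forall v q, queue S v = Some q ->
    [/\ end_node q = v, q = [::] \/ exists u, child (plist S) u v q
      & ~~ covers (plist S v) (cost q)];
  inv_queue_lex : forall u v q r,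
    r \in plist S u -> queue S v = Some q -> lexle (cbar r) (cbar q);
  inv_nqp : forall u v g, g \in nqp S (u, v) -> child (plist S) u v g;
  inv_queued : forall u v q g, queue S v = Some q -> g \in nqp S (u, v) ->
    live (plist S) g -> lexle (cbar q) (cbar g);
  inv_unqueued : forall u v g, queue S v = None -> g \in nqp S (u, v) ->
    ~~ live (plist S) g;
  inv_sorted : forall u v,
    pairwise (fun q r => lexle (cbar q) (cbar r))
             [seq g <- nqp S (u, v) | live (plist S) g];
  inv_complete : forall g, generated (plist S) g ->
    [\/ g \in E, ~~ live (plist S) g, queue S (end_node g) = Some g
      | exists u, g \in nqp S (u, end_node g)]
}.

(** * Liveness, extracted paths and the scan of one list *)

Lemma end_rcons p w : end_node (rcons p w) = w.
Proof. by rewrite /end_node last_rcons. Qed.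

Lemma penultimate_rcons p w : penultimate s (rcons p w) = end_node p.
Proof.
rewrite /penultimate size_rcons /= -rcons_cons nth_rcons /= ltnSn.
by rewrite nth_last.
Qed.

Lemma upd_same (T : eqType) (U : Type) (f : T -> U) a b : upd f a b a = b.
Proof. by rewrite /upd eqxx. Qed.

Lemma upd_other (T : eqType) (U : Type) (f : T -> U) a b x :
  x != a -> upd f a b x = f x.
Proof. by rewrite /upd => /negbTE ->. Qed.

Lemma covers_sub X Y x : {subset X <= Y} -> covers X x -> covers Y x.
Proof. by move=> sXY /hasP[q /sXY qY le_qx]; apply/hasP; exists q. Qed.

Lemma covers_le X x y : vle x y -> covers X x -> covers X y.
Proof.
by move=> xy /hasP[q qX le_qx]; apply/hasP; exists q => //; apply: vle_trans xy.
Qed.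

Lemma covers_mem X p : p \in X -> covers X (cost p).
Proof. by move=> pX; apply/hasP; exists p => //; apply: vle_refl. Qed.

(** The extracted lists only grow, so a path that is not live never becomes live again; dropping or
    skipping it is therefore harmless. *)
Lemma live_sub P P' g :
  (forall v, {subset P v <= P' v}) -> live P' g -> live P g.
Proof.
move=> sPP'; rewrite /live /prunable -!negb_or; apply: contra.
case/orP => [/orP[|->]|]; rewrite ?orbT // => /(covers_sub (sPP' _)) ->;
  by rewrite ?orbT.
Qed.

Lemma live_not_mem P g : g \in P (end_node g) -> ~~ live P g.
Proof. by move=> gP; rewrite /live covers_mem ?andbF. Qed.

Lemma cbar_rcons p w : A (end_node p) w -> vle (cbar p) (cbar (rcons p w)).
Proof.
have [_ mono] := pi_mono; move=> Apw.
rewrite /cbar end_rcons cost_rcons -addrA.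
exact: vle_add (vle_refl _) (mono _ _ Apw).
Qed.

Lemma sound_last P u r : sound P -> r \in P u -> end_node r = u.
Proof. by move=> sP /(sound_path sP)/and3P[_ /eqP]. Qed.

Lemma sound_cat P u q r : sound P -> q ++ r \in P u -> q \in P (end_node q).
Proof.
move=> sP; elim/last_ind: r u => [|r w IHr] u.
  by rewrite cats0 => qP; rewrite (sound_last sP qP).
by rewrite -rcons_cat => /(sound_prefix sP)/IHr.
Qed.

Lemma child_path P u v g : sound P -> child P u v g -> path A s g.
Proof.
move=> sP [r rP [-> Auv]]; have /and3P[pathr /eqP lastr _] := sound_path sP rP.
by rewrite rcons_path pathr lastr.
Qed.

Lemma child_end P u v g : child P u v g -> end_node g = v.
Proof. by case=> r _ [-> _]; rewrite end_rcons. Qed.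

(** If the parent of [g] already visited [v], its prefix ending at [v] would itself be extracted,
    and since arc costs are nonnegative it would cover [g]. *)
Lemma child_simple P u v g : sound P -> child P u v g ->
  ~~ covers (P v) (cost g) -> is_path A s v g.
Proof.
move=> sP chg ncov; have pathg := child_path sP chg.
have endg := child_end chg; case: chg => r rP [def_g Auv].
rewrite /is_path pathg -endg eqxx /= -cons_uniq def_g -rcons_cons rcons_uniq.
have /and3P[pathr _ ->] := sound_path sP rP; rewrite andbT.
apply: contra ncov => vr.
have [r1 [r2 [def_r endr1]]] : exists r1 r2, r = r1 ++ r2 /\ end_node r1 = v.
  by case/splitPl: vr => r1 r2 <-; exists r1, r2.
rewrite def_r in rP; have r1P := sound_cat sP rP; rewrite endr1 in r1P.
apply/hasP; exists r1 => //.
rewrite def_g def_r -cats1 -catA cost_cat -[X in vle X]addr0.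
apply: vle_add; first exact: vle_refl.
apply: (cost_ge0 c_ge0); move: pathg.
by rewrite def_g def_r -cats1 -catA cat_path => /andP[].
Qed.

Lemma queued_path E S v q :
  inv E S -> queue S v = Some q -> is_path A s v q.
Proof.
move=> iS /(inv_queue iS)[endq + ncov]; case=> [q0|[u chq]].
  by rewrite -endq q0 /is_path /= eqxx.
exact: (child_simple (inv_sound iS) chq).
Qed.

(** Ensures that the empty path, which has no last arc, is never displaced from the queue into an
    NQP list. *)
Lemma nil_lex_min g : path A s g -> end_node g = s -> lexle (cbar [::]) (cbar g).
Proof.
move=> pathg endg; apply: vle_lexle; rewrite /cbar cost_nil endg.
by apply: vle_add; [apply: (cost_ge0 c_ge0) | apply: vle_refl].
Qed.

(** As [p] is already in its list, the test against [cost p] is subsumed by the covering test. Hence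
    the scan stops exactly at the first live path, and all it removes is prunable. *)
Lemma scanP P p L o :
  p \in P (end_node p) -> (forall g, g \in L -> end_node g = end_node p) ->
  [/\ subseq (scan P p L o).1 L,
      filter (live P) (scan P p L o).1 = filter (live P) L
    & (scan P p L o).2 =
        if filter (live P) L is r :: _
        then if lex_better r o then Some r else o else o].
Proof.
move=> pP; elim: L => [|r L IHL] //= endL.
have endr : end_node r = end_node p by apply: endL; rewrite mem_head.
have {IHL}[|subL liveL newL] := IHL.
  by move=> g gL; apply: endL; rewrite inE gL orbT.
case: ifP => pruner.
  have -> : live P r = false by rewrite /live pruner.
  split=> //.
  exact: subseq_trans subL (subseq_cons _ _).
have -> : ~~ covers (P (end_node p)) (cost r) && ~~ vle (cost p) (cost r) =
    live P r.
  rewrite /live pruner endr /= andb_idr //; apply: contra => le_pr.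
  by apply/hasP; exists p.
case: ifP => liver /=; first by rewrite liver eqxx subseq_refl.
case: (scan P p L o) subL liveL newL => L1 o1 /= subL liveL newL.
by rewrite eqxx liver; split.
Qed.

(** * Preservation of the invariant by arc propagation *)

Lemma inv_processed g E S : inv (g :: E) S ->
  [\/ ~~ live (plist S) g, queue S (end_node g) = Some g
    | exists u, g \in nqp S (u, end_node g)] -> inv E S.
Proof.
move=> [sP iQ iQlex iN iQd iUq iS iC] done_g; split=> // h /iC[].
- rewrite inE => /orP[/eqP ->|hE]; last by constructor 1.
  by case: done_g; [constructor 2 | constructor 3 | constructor 4].
- by constructor 2.
- by constructor 3.
- by constructor 4.
Qed.

(** Only the elements of [L] and the order of its live part matter, so this serves both appending
    [g] and inserting it at the front. *)
Lemma inv_store E Q P N u v q g L :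
  inv E (State Q P N) -> Q v = Some q -> child P u v g ->
  lexle (cbar q) (cbar g) -> L =i g :: N (u, v) ->
  pairwise (fun q r => lexle (cbar q) (cbar r)) [seq g <- L | live P g] ->
  inv E (State Q P (upd N (u, v) L)).
Proof.
move=> [/= sP iQ iQlex iN iQd iUq iS iC] Qv chg le_qg defL sortL.
have mem_upd u' v' h : h \in upd N (u, v) L (u', v') ->
    h \in N (u', v') \/ [/\ u' = u, v' = v & h = g].
  rewrite /upd; case: eqP => [[-> ->]|_]; last by left.
  by rewrite defL inE => /orP[/eqP ->|]; [right | left].
split=> //=.
- by move=> u' v' h /mem_upd[/iN|[-> -> ->]].
- move=> u' v' q' h Qv' /mem_upd[/iQd|[_ def_v' ->]]; first exact.
  by move: Qv'; rewrite def_v' Qv => -[<-].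
- move=> u' v' h Qv' /mem_upd[/iUq|[_ def_v']]; first exact.
  by rewrite def_v' Qv in Qv'.
- by move=> u' v'; rewrite /upd; case: eqP.
- move=> h /iC[hE|dead|queued|[x stored]].
  + by constructor 1.
  + by constructor 2.
  + by constructor 3.
  + constructor 4; exists x; rewrite /upd; case: eqP => [eq_x|//].
    by rewrite defL inE -eq_x stored orbT.
Qed.

(** The last hypothesis keeps [inv_complete] when [p] displaces a queued path: that path must
    already be stored in an NQP list. *)
Lemma inv_enqueue E Q P N u w p :
  inv E (State Q P N) -> child P u w p -> ~~ covers (P w) (cost p) ->
  (forall v r, r \in P v -> lexle (cbar r) (cbar p)) ->
  (forall v g, g \in N (v, w) -> live P g -> lexle (cbar p) (cbar g)) ->
  (forall q, Q w = Some q -> exists v, q \in N (v, w)) ->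
  inv E (State (enqueue p Q) P N).
Proof.
move=> [/= sP iQ iQlex iN iQd iUq iS iC] chp ncov min_p le_p stored_q.
have endp := child_end chp.
have enqE v : enqueue p Q v = if v == w then Some p else Q v.
  by rewrite /enqueue endp.
split=> //=.
- move=> v q; rewrite enqE; case: eqP => [-> [<-]|_ /iQ //].
  by split=> //; right; exists u.
- move=> v v' q r rP; rewrite enqE; case: eqP => [_ [<-]|_]; last exact: iQlex rP.
  exact: min_p rP.
- move=> u' v q g; rewrite enqE; case: eqP => [-> [<-]|_]; last exact: iQd.
  exact: le_p.
- by move=> u' v g; rewrite enqE; case: eqP => // _; apply: iUq.
- move=> g /iC[gE|dead|queued|stored].
  + by constructor 1.
  + by constructor 2.
  + have [eq_w|ne_w] := eqVneq (end_node g) w.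
      by constructor 4; rewrite eq_w; apply: stored_q; rewrite -eq_w.
    by constructor 3; rewrite enqE (negbTE ne_w).
  + by constructor 4.
Qed.

Lemma propagate_arc_inv E S p w :
  inv (rcons p w :: E) S -> p \in plist S (end_node p) ->
  (forall u r, r \in plist S u -> lexle (cbar r) (cbar p)) ->
  A (end_node p) w ->
  inv E (propagate_arc c s t pi beta p S w).
Proof.
case: S => Q P N iS /= pP min_p Apw.
set qnew := rcons p w; have endq : end_node qnew = w := end_rcons p w.
have chq : child P (end_node p) w qnew by exists p.
have sP := inv_sound iS.
have min_q u r : r \in P u -> lexle (cbar r) (cbar qnew).
  by move=> /min_p le_rp; apply: lexle_trans le_rp (vle_lexle (cbar_rcons Apw)).
rewrite /propagate_arc -/qnew.
case: ifP => [dead|/negbT].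
  apply: inv_processed iS _; constructor 1 => /=.
  by rewrite /live -negb_or negbK endq.
rewrite negb_or => /andP[_ ncov].
case def_Qw: (Q w) => [q|]; last first.
  apply: (@inv_processed qnew).
    apply: (inv_enqueue iS chq) => // [v g gN | q]; last by rewrite def_Qw.
    (* With nothing queued at [w], no stored path to [w] is live, so the minimality condition is
       vacuous. *)
    by move=> lg; have := inv_unqueued iS def_Qw gN; rewrite /= lg.
  by constructor 2; rewrite /= /enqueue upd_same.
have [/= endq' orig_q ncov_q] := inv_queue iS def_Qw.
case: ifP => [lt_qnew | /negbT le_q]; last first.
  apply: (@inv_processed qnew); last first.
    by constructor 3; exists (end_node p); rewrite /= endq upd_same mem_rcons mem_head.
  apply: (inv_store iS def_Qw chq le_q); first exact: mem_rcons.
  rewrite filter_rcons; case: ifP => _; last exact: (inv_sorted iS).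
  rewrite pairwise_rcons (inv_sorted iS) andbT; apply/allP => g /=.
  rewrite mem_filter => /andP[_ /(inv_nqp iS)[r /= rP [-> _]]].
  (* [g] and [qnew] extend paths to the same node by the same arc, so they
     compare as their parents, and [p] was extracted last. *)
  have := min_p _ _ rP; rewrite /lexle /cbar !end_rcons !cost_rcons.
  have -> : last s r = last s p := sound_last sP rP.
  rewrite (_ : end_node r = end_node p); last exact: (sound_last sP rP).
  by rewrite !lexlt_add2r.
(* The displaced [q] is nonempty by [nil_lex_min], so it has a last arc. *)
have chq' : child P (penultimate s q) w q.
  case: orig_q => [q0|[u [r rP [def_q Auw]]]].
    have := nil_lex_min (child_path sP chq).
    by rewrite -q0 /lexle lt_qnew /= endq -endq' q0 => /(_ erefl).
  by exists r; rewrite def_q penultimate_rcons (sound_last sP rP).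
apply: (@inv_processed qnew); last by constructor 2; rewrite /= /enqueue upd_same.
(* [q] is stored while still queued: it is lexicographically at most every live path of that list,
   so inserting it at the front keeps the live part sorted. *)
have iS' : inv (qnew :: E)
    (State Q P (upd N (penultimate s q, w) (q :: N (penultimate s q, w)))).
  apply: (inv_store iS def_Qw chq' (lexle_refl _)) => //=.
  case: ifP => _; last exact: (inv_sorted iS).
  rewrite pairwise_cons (inv_sorted iS) andbT; apply/allP => g.
  by rewrite mem_filter => /andP[lg gN]; apply: (inv_queued iS def_Qw gN).
apply: (inv_enqueue iS' chq) => // [v g gN lg|q'].
  apply: lexle_trans (lexltW lt_qnew) _.
  exact: (inv_queued iS' def_Qw gN).
rewrite def_Qw => -[<-]; exists (penultimate s q).
by rewrite upd_same mem_head.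
Qed.

Lemma plist_propagate_arc S p w :
  plist (propagate_arc c s t pi beta p S w) = plist S.
Proof.
case: S => Q P N; rewrite /propagate_arc /=.
by case: ifP => // _; case: (Q w) => // q; case: ifP.
Qed.

Lemma propagate_inv S p ws :
  inv (if end_node p == t then [::] else [seq rcons p w | w <- ws]) S ->
  p \in plist S (end_node p) ->
  (forall u r, r \in plist S u -> lexle (cbar r) (cbar p)) ->
  {in ws, forall w, A (end_node p) w} ->
  inv [::] (propagate c s t pi beta S p ws) /\
  plist (propagate c s t pi beta S p ws) = plist S.
Proof.
rewrite /propagate; case: ifP => // _.
elim: ws S => //= w ws IHws S iS pP min_p Aws.
have Apw : A (end_node p) w by apply: Aws; rewrite mem_head.
have iS' := propagate_arc_inv iS pP min_p Apw.
have [|||iF ->] := IHws _ iS'; rewrite ?plist_propagate_arc //.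
by move=> x xws; apply: Aws; rewrite inE xws orbT.
Qed.

(** * Extraction and the next queue path search *)

Definition scan_list P p (acc : (V * V -> seq (seq V)) * option (seq V)) u :=
  let: (N, o) := acc in
  let: (L, o') := scan P p (N (u, end_node p)) o in
  (upd N (u, end_node p) L, o').

(** The competitors for the next queue path: the current choice [o] and the live paths in the lists
    still to be scanned. *)
Definition candidate P v (N : V * V -> seq (seq V)) o (us : seq V) g : Prop :=
  o = Some g \/ exists2 u, u \in us & g \in [seq r <- N (u, v) | live P r].

(** The live part of each list is sorted, so its first element is minimal there; comparing only
    these first elements thus finds a lexicographic minimum of all candidates. *)
Lemma foldl_scan_list P p us N o :
  p \in P (end_node p) ->
  (forall u g, g \in N (u, end_node p) -> end_node g = end_node p) ->
  (forall u, pairwise (fun q r => lexle (cbar q) (cbar r))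
                      [seq g <- N (u, end_node p) | live P g]) ->
  [/\ forall e, subseq ((foldl (scan_list P p) (N, o) us).1 e) (N e),
      forall e, [seq g <- (foldl (scan_list P p) (N, o) us).1 e | live P g] =
                [seq g <- N e | live P g],
      forall r, (foldl (scan_list P p) (N, o) us).2 = Some r ->
        candidate P (end_node p) N o us r
    & forall g, candidate P (end_node p) N o us g ->
        exists2 r, (foldl (scan_list P p) (N, o) us).2 = Some r &
                   lexle (cbar r) (cbar g)].
Proof.
move=> pP; set v := end_node p.
elim: us N o => [|u us IHus] N o endN sortN /=.
  split=> // [r -> | g [->|[]//]]; first by left.
  by exists g; rewrite ?lexle_refl.
have [] := scanP o pP (endN u).
rewrite -/v; case: (scan P p (N (u, v)) o) => L o1 /= subL liveL def_o1.
set N1 := upd N (u, v) L.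
have subN1 e : subseq (N1 e) (N e).
  by rewrite /N1 /upd; case: eqP => [->|].
have liveN1 e : [seq g <- N1 e | live P g] = [seq g <- N e | live P g].
  by rewrite /N1 /upd; case: eqP => [->|].
have [||sub live' sound' min'] := IHus N1 o1.
- by move=> u' g /(mem_subseq (subN1 _)); apply: endN.
- by move=> u'; rewrite liveN1.
have sortu := sortN u.
split.
- by move=> e; apply: subseq_trans (sub e) (subN1 e).
- by move=> e; rewrite live' liveN1.
- move=> r /sound'[|[u' u'us]]; last first.
    by rewrite liveN1 => rN; right; exists u' => //; rewrite inE u'us orbT.
  rewrite def_o1; case def_F: [seq _ <- _ | _] => [|r0 F] def_r; first by left.
  case: ifP def_r => [_ [<-]|_ ->]; last by left.
  by right; exists u; rewrite ?mem_head // def_F mem_head.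
- move=> g cand.
  have [later|[r def_r le_rg]] : candidate P v N1 o1 us g \/
      exists2 r, o1 = Some r & lexle (cbar r) (cbar g).
  + case: cand => [def_o|[u']].
      right; rewrite def_o1 def_o; case: [seq _ <- _ | _] => [|r0 F].
        by exists g; rewrite ?lexle_refl.
      case: ifP => [/lexltW le_r0|_]; first by exists r0.
      by exists g; rewrite ?lexle_refl.
    rewrite inE => /orP[/eqP ->|u'us gN]; last first.
      by left; right; exists u' => //; rewrite liveN1.
    move=> gN; right; rewrite def_o1; move: sortu gN.
    case: [seq _ <- _ | _] => [|r0 F] //= /andP[/allP le_r0 _] gF.
    have le_r0g : lexle (cbar r0) (cbar g).
      move: gF; rewrite inE => /orP[/eqP ->|]; first exact: lexle_refl.
      exact: le_r0.
    case: ifP => [_|]; first by exists r0.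
    case: (o) => //= r /negbT le_r; exists r => //.
    exact: lexle_trans le_r le_r0g.
  + exact: min'.
  + have [r' -> le_r'] := min' r (or_introl def_r).
    by exists r'; rewrite ?(lexle_trans le_r').
Qed.


Lemma sound_extract S p :
  inv [::] S -> queue S (end_node p) = Some p -> sound (plist (extract s S p)).
Proof.
move=> iS Qp; have sP := inv_sound iS; have [_ orig ncov] := inv_queue iS Qp.
rewrite /extract /=; set v := end_node p in Qp ncov *.
have sPP' u : {subset plist S u <= upd (plist S) v (rcons (plist S v) p) u}.
  move=> r rP; rewrite /upd; case: eqP => // <-.
  by rewrite mem_rcons inE rP orbT.
split=> [u r|u r w|u]; rewrite {1}/upd; case: eqP => [eq_u|_].
- rewrite eq_u mem_rcons inE => /orP[/eqP ->|]; last exact: sound_path.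
  exact: queued_path iS Qp.
- exact: sound_path.
- rewrite mem_rcons inE => /orP[/eqP def_p|/(sound_prefix sP)/sPP' //].
  case: orig => [p0|[x [q qP [def_p' _]]]].
    by have := congr1 size def_p; rewrite p0 size_rcons.
  move: def_p'; rewrite -{1}def_p => /rcons_inj[-> _].
  by apply: sPP'; rewrite (sound_last sP qP).
- by move=> /(sound_prefix sP)/sPP'.
- rewrite pairwise_rcons (sound_order sP) andbT; apply/allP => r rP /=.
  rewrite (inv_queue_lex iS rP Qp) andbT; apply: contra ncov => le_rp.
  by apply/hasP; exists r.
- exact: sound_order.
Qed.

Lemma next_queue_path_inv S p us ws :
  inv [::] S -> extractable c s pi S p ->
  (forall u, A u (end_node p) -> u \in us) ->
  (forall w, A (end_node p) w -> w \in ws) ->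
  let S1 := next_queue_path c s t pi beta (extract s S p) p us in
  inv (if end_node p == t then [::] else [seq rcons p w | w <- ws]) S1 /\
  plist S1 = plist (extract s S p).
Proof.
move=> iS [Qp min_p] in_us out_ws.
have sP := inv_sound iS; have sP' := sound_extract iS Qp.
have [_ _ ncov_p] := inv_queue iS Qp.
set v := end_node p; set P' := plist (extract s S p) in sP' *.
have memP' u r : r \in P' u -> r \in plist S u \/ u = v /\ r = p.
  rewrite /P' /= /upd; case: eqP => [->|_]; last by left.
  by rewrite mem_rcons inE => /orP[/eqP ->|]; [right | left].
have sPP' u : {subset plist S u <= P' u}.
  move=> r rP; rewrite /P' /= /upd; case: eqP => // <-.
  by rewrite mem_rcons inE rP orbT.
have P'other u : u != v -> P' u = plist S u by exact: upd_other.
have pP' : p \in P' v by rewrite /P' /= upd_same mem_rcons mem_head.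
have livePP' g : live P' g -> live (plist S) g by exact: live_sub.
have min_p' v' q : queue S v' = Some q -> lexle (cbar p) (cbar q).
  exact: min_p.
have [||subN liveN sound_new min_new] :=
  @foldl_scan_list P' p us (nqp S) None pP'.
- by move=> u g /(inv_nqp iS)/child_end.
(* What is live for [P'] was live before the extraction, so the new live part is a sublist of a
   sorted one. *)
- move=> u; have := pairwise_filter (live P') (inv_sorted iS u v).
  rewrite -filter_predI; congr (pairwise _ _); apply: eq_filter => g /=.
  by case lg: (live P' g) => //=; rewrite livePP'.
rewrite /= -/v in sound_new min_new *.
(* The anonymous fold step of [next_queue_path] is convertible to [scan_list P' p]. *)
have -> : next_queue_path c s t pi beta (extract s S p) p us =
    let: (N, pnew) := foldl (scan_list P' p) (nqp S, None) us in
    State (if pnew is Some r then enqueue r (upd (queue S) v None)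
           else upd (queue S) v None) P' N by [].
case: (foldl _ _ us) subN liveN sound_new min_new.
move=> N1 pnew /= subN liveN sound_new min_new; split=> //.
have in_live e g : g \in N1 e -> live P' g -> g \in [seq r <- nqp S e | live P' r].
  by move=> gN lg; rewrite -liveN mem_filter lg.
have cand u g : g \in N1 (u, v) -> live P' g -> candidate P' v (nqp S) None us g.
  move=> gN lg; have gN' := in_live _ _ gN lg; right; exists u => //.
  move: gN'; rewrite mem_filter => /andP[_ /(inv_nqp iS)[r _ [_ Auv]]].
  exact: in_us.
have {}sound_new r : pnew = Some r ->
    live P' r /\ exists2 u, child (plist S) u v r & r \in nqp S (u, v).
  move=> /sound_new[//|[u _]]; rewrite mem_filter => /andP[lr rN].
  by split=> //; exists u => //; exact: (inv_nqp iS rN).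
set Q1 := (X in State X _ _).
have Q1E u : Q1 u = if u == v then pnew else queue S u.
  rewrite /Q1; case: (pnew) sound_new => [r /(_ _ erefl)[_ [x /child_end endr _]]|_].
    by rewrite /enqueue endr /upd; case: eqP.
  by rewrite /upd; case: eqP.
have child_sub u w g : child (plist S) u w g -> child P' u w g.
  by case=> r /sPP' rP' def_g; exists r.
split=> //=.
- move=> u q; rewrite Q1E; case: eqP => [-> /sound_new[lq [x chq _]]|ne_u Qu].
    split; [exact: child_end chq | by right; exists x; apply: child_sub |].
    by move: lq; rewrite /live (child_end chq) => /andP[].
  have [endq orig ncov] := inv_queue iS Qu.
  rewrite P'other; last exact/eqP.
  split=> //; case: orig => [|[x chq]]; [by left | right].
  by exists x; apply: child_sub.
- move=> u w q r rP'; rewrite Q1E => Qq.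
  (* A newly queued path was live in an NQP list while [p] was queued at the same node; any other
     one lost the comparison with [p] at extraction. *)
  have le_pq : lexle (cbar p) (cbar q).
    move: Qq; case: eqP => [_ /sound_new[lq [x _ qN]]|_]; last exact: min_p'.
    exact: (inv_queued iS Qp qN (livePP' _ lq)).
  apply: lexle_trans le_pq; case/memP': rP' => [rP|[_ ->]].
    exact: (inv_queue_lex iS rP Qp).
  exact: lexle_refl.
- by move=> u w g /(mem_subseq (subN _))/(inv_nqp iS)/child_sub.
- move=> u w q g; rewrite Q1E; case: eqP => [-> def_q gN lg|_ Qq gN lg].
    by have [r] := min_new _ (cand _ _ gN lg); rewrite def_q => -[->].
  exact: (inv_queued iS Qq (mem_subseq (subN _) gN) (livePP' _ lg)).
- move=> u w g; rewrite Q1E; case: eqP => [-> def_q gN|_ Qq gN].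
    by apply/negP => /(cand _ _ gN)/min_new[r]; rewrite def_q.
  apply: contra (inv_unqueued iS Qq (mem_subseq (subN _) gN)); exact: livePP'.
- move=> u w; rewrite liveN.
  have := pairwise_filter (live P') (inv_sorted iS u w).
  rewrite -filter_predI; congr (pairwise _ _); apply: eq_filter => g /=.
  by case lg: (live P' g) => //=; rewrite livePP'.
- move=> g gen_g; have [lg|] := boolP (live P' g); last by constructor 2.
  have [gen_g'|] : generated (plist S) g \/
      g \in (if v == t then [::] else [seq rcons p w | w <- ws]).
  + case: gen_g => [|[r [w [def_g rP' ne_t Arw]]]]; first by left; left.
    case/memP': rP' => [rP|[_ def_r]]; first by left; right; exists r, w.
    move: ne_t Arw def_g; rewrite def_r -/v => /negbTE -> Apw ->.
    by right; apply: map_f; apply: out_ws.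
  + case: (inv_complete iS gen_g') => [//|dead|Qg|[x gN]].
    * by rewrite (livePP' _ lg) in dead.
    (* The path that was queued at [v] is [p] itself, which its own extraction has made not live. *)
    * have [eq_v|ne_v] := eqVneq (end_node g) v.
        move: Qg; rewrite eq_v Qp => -[def_g]; move: lg; rewrite -def_g.
        by move=> lp; have := live_not_mem pP'; rewrite lp.
      by constructor 3; rewrite Q1E (negbTE ne_v).
    * constructor 4; exists x.
      have: g \in [seq r <- nqp S (x, end_node g) | live P' r].
        by rewrite mem_filter lg.
      by rewrite -liveN mem_filter => /andP[].
  + by constructor 1.
Qed.

(** The second conjunct, one more extracted path per iteration, is what the termination argument
    counts. *)
Lemma iteration_inv S S' : inv [::] S -> iteration A c s t pi beta S S' ->
  inv [::] S' /\
  exists p, plist S' = upd (plist S) (end_node p)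
                           (rcons (plist S (end_node p)) p).
Proof.
move=> iS [p [us [ws [ex_p perm_us perm_ws ->]]]].
have [Qp min_p] := ex_p.
have [||iS1 plistS1] := next_queue_path_inv (us := us) (ws := ws) iS ex_p.
- by move=> u Aup; rewrite (perm_mem perm_us) mem_filter Aup mem_enum.
- by move=> w Apw; rewrite (perm_mem perm_ws) mem_filter Apw mem_enum.
have [|||iS' ->] := propagate_inv iS1; last by split=> //; exists p; rewrite plistS1.
- by rewrite plistS1 /= upd_same mem_rcons mem_head.
- move=> u r; rewrite plistS1 /= /upd; case: eqP => [_|_ rP].
    rewrite mem_rcons inE => /orP[/eqP ->|rP]; first exact: lexle_refl.
    exact: (inv_queue_lex iS rP Qp).
  exact: (inv_queue_lex iS rP Qp).
- by move=> w; rewrite (perm_mem perm_ws) mem_filter => /andP[].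
Qed.

Lemma initial_inv : inv [::] (initial_state s).
Proof.
split=> //=.
- move=> v q; rewrite /enqueue /upd; case: eqP => // -> [<-].
  by split=> //; left.
- move=> g [->|[r [w []]]] //; constructor 3.
  by rewrite /enqueue upd_same.
Qed.

Lemma reachable_inv S : reachable A c s t pi beta S -> inv [::] S.
Proof.
by elim=> [|S1 S2 _ iS1 /(iteration_inv iS1)[]//]; apply: initial_inv.
Qed.

(** * Termination and progress *)

Lemma pairwise_mem (T : eqType) (e : rel T) (L : seq T) (x y : T) :
  pairwise e L -> x \in L -> y \in L -> [\/ x = y, e x y | e y x].
Proof.
elim: L => //= z L IHL /andP[/allP ez eL]; rewrite !inE.
case/orP => [/eqP ->|xL] /orP[/eqP ->|yL].
- by constructor 1.
- by constructor 2; apply: ez.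
- by constructor 3; apply: ez.
- exact: IHL.
Qed.

Lemma sound_uniq P u : sound P -> uniq (P u).
Proof.
move=> sP; apply: (pairwise_uniq _ (sound_order sP u)) => p.
by rewrite vle_refl.
Qed.

Lemma sound_size P u :
  sound P -> (size (P u) <= #|{: #|V|.-bseq V}|)%N.
Proof.
(* The extracted paths are distinct and simple, hence distinct sequences of length at most
   [#|V|]. *)
move=> sP; rewrite cardE -(size_map val).
apply: uniq_leq_size (sound_uniq _ sP) _ => p pP.
have szp := size_simple_path (sound_path sP pP).
by apply/mapP; exists (Bseq szp); rewrite ?mem_enum.
Qed.

Lemma no_infinite_run : ~ exists run, infinite_run A c s t pi beta run.
Proof.
move=> [run [run0 runS]].
have inv_run n : inv [::] (run n).
  elim: n => [|n IHn]; first by rewrite run0; apply: initial_inv.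
  by have [] := iteration_inv IHn (runS n).
have total n : (\sum_u size (plist (run n) u) = n)%N.
  elim: n => [|n IHn]; first by rewrite run0 big1.
  have [_ [p ->]] := iteration_inv (inv_run n) (runS n).
  rewrite -[in RHS]IHn (bigD1 (end_node p)) //= [in RHS](bigD1 (end_node p)) //=.
  rewrite upd_same size_rcons addSn; congr (_ + _).+1%N.
  by apply: eq_bigr => u ne_u; rewrite upd_other.
pose b := (\sum_(u : V) #|{: #|V|.-bseq V}|)%N.
have : (b.+1 <= b)%N; last by rewrite ltnn.
(* After [b.+1] iterations the lists hold [b.+1] paths in total, more than their size bounds
   allow. *)
rewrite -{1}(total b.+1); apply: leq_sum => u _.
exact: sound_size (inv_sound (inv_run _)).
Qed.

Lemma progress S : inv [::] S -> ~ finished S ->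
  exists S', iteration A c s t pi beta S S'.
Proof.
move=> iS unfinished.
have /existsP[v0 Qv0] : [exists v, queue S v != None].
  apply: contraT; rewrite negb_exists => /forallP noQ; case: unfinished => v.
  by apply/eqP; have := noQ v; rewrite negbK.
(* The default [[::]] is never compared: the minimum ranges over nodes with a queued path. *)
pose key v := cbar (odflt [::] (queue S v)).
have tot : total (@lexle R d).
  move=> x y; case xy: (lexle x y) => //=.
  by move/negbFE: xy => /lexltW.
case: (extremumP (P := fun v => queue S v != None) key
         (@lexle_refl R d) (@lexle_trans R d) tot Qv0) => v.
case def_p: (queue S v) => [p|] // _ min_p.
have [endp _ _] := inv_queue iS def_p.
eexists; exists p, [seq u <- enum V | A u (end_node p)],
  [seq w <- enum V | A (end_node p) w]; split=> //.
split; rewrite ?endp // => w q def_q.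
by have := min_p w; rewrite /key def_q def_p => /(_ isT).
Qed.

(** * Correctness of the final list *)

Lemma finished_covers S q : inv [::] S -> finished S ->
  dominance_bound A c s t beta -> efficient A c s t q ->
  covers (plist S t) (cost q).
Proof.
move=> iS finS bound eff_q; have [/and3P[pathq /eqP lastq uniq_q] _] := eff_q.
have sP := inv_sound iS.
apply/negPn/negP => ncov.
(* A generated [g'] at most as costly as the prefix [g] of [q] has [cbar] below [cost q]. It is not
   live, and pruning it would make [P_st] cover [q] or contradict the dominance bound; so it is
   covered, and [g] with it. *)
have step g r : q = g ++ r -> forall g', generated (plist S) g' ->
    vle (cost g') (cost g) -> end_node g' = end_node g ->
    covers (plist S (end_node g)) (cost g).
  move=> def_q g' gen_g' le_g' end_g'.
  have le_q : vle (cbar g') (cost q).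
    rewrite /cbar end_g' def_q cost_cat; apply: vle_add le_g' _.
    apply: (monotone_le_cost pi_mono); first last.
      by rewrite -lastq def_q last_cat.
    by move: pathq; rewrite def_q cat_path => /andP[].
  have dead : ~~ live (plist S) g'.
    case: (inv_complete iS gen_g') => [//|//||[u gN]]; first by rewrite finS.
    exact: (inv_unqueued iS (finS _) gN).
  move: dead; rewrite /live -negb_or negbK -end_g' => /orP[/orP[cov|le_beta]|].
  - by have := covers_le le_q cov; rewrite (negbTE ncov).
  - by case: bound; exists q => //; apply: vle_trans le_q.
  - exact: covers_le.
have prefix_covered g r : q = g ++ r -> covers (plist S (end_node g)) (cost g).
  elim/last_ind: g r => [|g w IHg] r def_q.
    by apply: (step _ _ def_q [::]) => //; [left | apply: vle_refl].
  rewrite cat_rcons in def_q.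
  have /hasP[g' g'P le_g'] := IHg _ def_q.
  have endg' : end_node g' = end_node g := sound_last sP g'P.
  have Agw : A (end_node g) w.
    by move: pathq; rewrite def_q cat_path => /and3P[].
  apply: (step _ r _ (rcons g' w)); rewrite ?cat_rcons ?end_rcons //.
    right; exists g', w; rewrite endg'; split=> //.
    (* A proper prefix of the simple path [q] cannot end at [t], so [g'] has been propagated. *)
    apply/negP => /eqP endg; move: uniq_q.
    rewrite def_q -cat_cons cat_uniq => /and3P[_ /hasP[]].
    exists t; last by rewrite -endg mem_last.
    by rewrite -lastq def_q last_cat /= mem_last.
  rewrite !cost_rcons (_ : last s g' = last s g) //.
  exact: vle_add le_g' (vle_refl _).
by have := prefix_covered q [::]; rewrite cats0 /end_node lastq (negbTE ncov) => /(_ erefl).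
Qed.

(** An earlier path of the list never covers a later one, so a distinct [p] below [q] must have been
    extracted after [q]. *)
Lemma sound_order_mem P u p q : sound P -> p \in P u -> q \in P u ->
  vle (cost p) (cost q) ->
  p = q \/ lexle (cbar q) (cbar p) /\ ~~ vle (cost q) (cost p).
Proof.
move=> sP pP qP le_pq.
have [->|/andP[]|/andP[]] := pairwise_mem (sound_order sP u) pP qP.
- by left.
- by rewrite le_pq.
- by right.
Qed.

Lemma finished_complete S : inv [::] S -> finished S ->
  dominance_bound A c s t beta -> minimal_complete_set A c s t (plist S t).
Proof.
move=> iS finS bound; have sP := inv_sound iS.
split; first exact: sound_uniq.
- move=> p pP; split=> [|q sim_q]; first exact: (sound_path sP pP).
  apply/negP => dom_qp.
  have [q' eff_q' le_q'] := efficient_below c sim_q.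
  have /hasP[r rP le_r] := finished_covers iS finS bound eff_q'.
  have /forallP le_rq := vle_trans le_r le_q'.
  have dom : dominates (cost r) (cost p).
    case/andP: dom_qp => le_qp /existsP[j lt_qp]; apply/andP; split.
      by apply: vle_trans le_qp; apply/forallP.
    by apply/existsP; exists j; apply: le_lt_trans (le_rq j) lt_qp.
  (* Both paths end at [t], so [r] is also strictly smaller in [cbar]; yet [r], covering [p], could
     only have been extracted after it. *)
  have lt_rp := dominates_lexlt dom; case/andP: dom => le_rp _.
  case: (sound_order_mem sP rP pP le_rp) => [eq_rp|[]].
    by rewrite eq_rp lexlt_irrefl in lt_rp.
  rewrite /lexle /cbar (sound_last sP rP) (sound_last sP pP) lexlt_add2r.
  by rewrite lt_rp.
- move=> y [q eff_q <-].
  have /hasP[p pP le_p] := finished_covers iS finS bound eff_q.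
  have eq_pq : cost p = cost q.
    apply/eqP; apply: contraT => /(vle_dominates le_p) dom.
    by have [_ /(_ p (sound_path sP pP))] := eff_q; rewrite dom.
  exists p; split=> // p' [p'P eq_p'].
  (* Of two distinct paths with equal cost, the earlier would cover the later. *)
  have [|//|[_]] := sound_order_mem sP pP p'P; rewrite eq_p' eq_pq vle_refl //.
Qed.

End Run.

(* Every run terminates, no run gets stuck before the queue is empty, and
   whenever the queue is empty, the list P_st is as claimed. *)
Theorem theorem1 (R : realType) (d : nat) (V : finType) (A : rel V) (s t : V)
    (c : V -> V -> 'rV[R]_d) (pi : V -> 'rV[R]_d) (beta : 'rV[R]_d)
    (c_ge0 : forall u v, A u v -> vle 0 (c u v))
    (pi_ge0 : forall v, vle 0 (pi v))
    (pi_monotone : monotone A c t pi)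
    (pi_admissible : admissible A c t pi)
    (beta_bound : dominance_bound A c s t beta) :
  [/\ ~ (exists r, infinite_run A c s t pi beta r),
      forall S, reachable A c s t pi beta S -> ~ finished S ->
        exists S', iteration A c s t pi beta S S'
    & forall S, reachable A c s t pi beta S -> finished S ->
        minimal_complete_set A c s t (plist S t)].

Proof.
split; first exact: no_infinite_run.
- by move=> S /(reachable_inv c_ge0 pi_monotone); apply: progress.
- move=> S /(reachable_inv c_ge0 pi_monotone) iS finS.
  exact: finished_complete iS finS beta_bound.
Qed.
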